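(* Let $n\ge 2$, and let $G$ be the group of upper triangular unipotent matrices in $GL(n,\mathbb{R})$, acting naturally on $\mathbb{R}^n$. Let $W$ be a finite-dimensional real vector space and let $L=\sum_{i=1}^n a_i(w,x)\frac{\partial}{\partial x_i}$ be a vector field on $\mathbb{R}^n$ with parameters $w\in W$, whose coefficients $a_i$ are $C^\infty$ functions (respectively polynomial functions) on $W\times\mathbb{R}^n$. Suppose that $L$ annihilates all $G$-invariant distributions on $\mathbb{R}^n$. Then there exist $C^\infty$ functions (respectively polynomial functions) $\varphi_{ij}$ on $W\times\mathbb{R}^n$, for $1\le i\le n-1$ and $i<j\le n$, such that $$L=\sum_{1\le i<j\le n}\varphi_{ij}\,L_{ij},\qquad L_{ij}=x_j\frac{\partial}{\partial x_i}.$$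
   Context: $G$ consists of the real matrices $g=(g_{ij})$ with $g_{ii}=1$ for all $i$ and $g_{ij}=0$ for $i>j$. The vector fields associated with the action of $G$ on $\mathbb{R}^n$ are spanned by the $L_{ij}=x_j\frac{\partial}{\partial x_i}$, $i<j$; a distribution $T$ on $\mathbb{R}^n$ is $G$-invariant if and only if $L_{ij}T=0$ for all $i<j$. The field $L$ with parameters annihilates a distribution $T$ on $\mathbb{R}^n$ if for every $w\in W$ one has $\sum_{i}a_i(w,\cdot)\frac{\partial T}{\partial x_i}=0$ as a distribution on $\mathbb{R}^n$. *)

(* Defs.v *)
From HB Require Import structures.
From mathcomp Require Import all_boot all_order all_algebra.
(* mpoly is not imported: its notations clash with those of the analysis
   library. *)
From mathcomp Require mpoly.
From mathcomp Require Import all_classical all_reals all_analysis.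

Set Implicit Arguments.
Unset Strict Implicit.
Unset Printing Implicit Defensive.

Import Order.TTheory GRing.Theory Num.Theory.
Import numFieldNormedType.Exports.

Local Open Scope classical_set_scope.
Local Open Scope ring_scope.

(* Points of R^n are row vectors; x 0 i is the i-th coordinate of x. *)

Definition partial (R : realType) (n : nat) (i : 'I_n) (f : 'rV[R]_n -> R) :
    'rV[R]_n -> R :=
  fun x => 'D_(delta_mx 0 i) f x.

(* The multi-index s is the sequence of the directions of differentiation,
   in the order in which they are written in d_{s_1} ... d_{s_k} f. *)
Definition iter_partial (R : realType) (n : nat) (s : seq 'I_n)
    (f : 'rV[R]_n -> R) : 'rV[R]_n -> R :=
  foldr (@partial R n) f s.

(* C^oo: the iterated partial derivatives of all orders exist and are
   continuous on R^n.  The existence clause is needed because 'D_v is total. *)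
Definition smooth (R : realType) (n : nat) (f : 'rV[R]_n -> R) : Prop :=
  forall s : seq 'I_n,
    continuous (iter_partial s f) /\
    (forall (i : 'I_n) (x : 'rV[R]_n),
       derivable (iter_partial s f) x (delta_mx 0 i)).

Definition supported_in (R : realType) (n : nat) (K : set 'rV[R]_n)
    (f : 'rV[R]_n -> R) : Prop :=
  [set x | f x != 0] `<=` K.

Definition test_function (R : realType) (n : nat) (f : 'rV[R]_n -> R) : Prop :=
  smooth f /\ exists2 K : set 'rV[R]_n, compact K & supported_in K f.

Definition sup_norm (R : realType) (n : nat) (f : 'rV[R]_n -> R) : R :=
  sup [set `|f x| | x in [set: 'rV[R]_n]].

(* Distributions are represented by functionals defined on all functions, of
   which only the values on test functions matter: every definition below
   quantifies over test functions only.  The last clause is continuity on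
   C_c^oo(R^n), in the form of the usual seminorm estimates on compact sets. *)
Definition distribution (R : realType) (n : nat)
    (T : ('rV[R]_n -> R) -> R) : Prop :=
  (forall (c : R) (f g : 'rV[R]_n -> R), test_function f -> test_function g ->
     T (fun x => c * f x + g x) = c * T f + T g) /\
  (forall K : set 'rV[R]_n, compact K ->
     exists (m : nat) (C : R),
       forall f : 'rV[R]_n -> R, test_function f -> supported_in K f ->
         `|T f| <= C * \sum_(k < m.+1) \sum_(s : k.-tuple 'I_n)
                         sup_norm (iter_partial s f)).

Definition distr_partial (R : realType) (n : nat) (i : 'I_n)
    (T : ('rV[R]_n -> R) -> R) : ('rV[R]_n -> R) -> R :=
  fun f => - T (partial i f).

Definition distr_mul (R : realType) (n : nat) (a : 'rV[R]_n -> R)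
    (T : ('rV[R]_n -> R) -> R) : ('rV[R]_n -> R) -> R :=
  fun f => T (fun x => a x * f x).

Definition unipotent_upper (R : realType) (n : nat) : set 'M[R]_n :=
  [set g | (forall i : 'I_n, g i i = 1) /\
           (forall i j : 'I_n, (j < i)%N -> g i j = 0)].

(* The natural action of g on column vectors, written on row vectors. *)
Definition mx_act (R : realType) (n : nat) (g : 'M[R]_n) (x : 'rV[R]_n) :
    'rV[R]_n :=
  x *m g^T.

Definition G_invariant (R : realType) (n : nat)
    (T : ('rV[R]_n -> R) -> R) : Prop :=
  forall g : 'M[R]_n, unipotent_upper g ->
  forall f : 'rV[R]_n -> R, test_function f ->
    T (fun x => f (mx_act g x)) = T f.

(* A vector field on R^n with parameters in W is a map W -> R^n -> R^n, and
   its coefficient a_i(w, x) is the i-th coordinate of its value at (w, x). *)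
Definition coefficient (R : realType) (W : vectType R) (n : nat)
    (L : W -> 'rV[R]_n -> 'rV[R]_n) (i : 'I_n) : W -> 'rV[R]_n -> R :=
  fun w x => L w x 0 i.

Definition annihilates (R : realType) (W : vectType R) (n : nat)
    (L : W -> 'rV[R]_n -> 'rV[R]_n) (T : ('rV[R]_n -> R) -> R) : Prop :=
  forall (w : W) (f : 'rV[R]_n -> R), test_function f ->
    \sum_(i < n) distr_mul (coefficient L i w) (distr_partial i T) f = 0.

Definition annihilates_invariants (R : realType) (W : vectType R) (n : nat)
    (L : W -> 'rV[R]_n -> 'rV[R]_n) : Prop :=
  forall T : ('rV[R]_n -> R) -> R,
    distribution T -> G_invariant T -> annihilates L T.

(* The field x_j d/dx_i. *)
Definition Lfield (R : realType) (n : nat) (i j : 'I_n) (x : 'rV[R]_n) :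
    'rV[R]_n :=
  x 0 j *: delta_mx 0 i.

(* v2r : W -> 'rV_(dim W) and its inverse r2v are the coordinate isomorphisms
   of the vectType W, which carries no topology of its own; smooth and
   polynomial functions on W * R^n are those which are so in the coordinates
   (v2r w, x).  Neither notion depends on the choice of linear coordinates. *)
Definition smooth_on_prod (R : realType) (W : vectType R) (n : nat)
    (F : W -> 'rV[R]_n -> R) : Prop :=
  smooth (fun z : 'rV[R]_(dim W + n) =>
            F (VectorInternalTheory.r2v (lsubmx z)) (rsubmx z)).

Definition polynomial_on_prod (R : realType) (W : vectType R) (n : nat)
    (F : W -> 'rV[R]_n -> R) : Prop :=
  exists p : mpoly.mpoly (dim W + n) R,
    forall (w : W) (x : 'rV[R]_n),
      F w x =
      mpoly.meval
        (fun k => row_mx (VectorInternalTheory.v2r w) x 0 k) p.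

(* Main.v *)
Require Import Defs.
From HB Require Import structures.
From mathcomp Require Import all_boot all_order all_algebra.
From mathcomp Require mpoly.
From mathcomp Require Import all_classical all_reals all_analysis.
From mathcomp Require Import ring lra.

(** The G-orbit of a point x whose last nonzero coordinate is x_k is the affine
    space {y | y_l = x_l for l >= k}.  Integrating successively in y_1, ...,
    y_(k-1) gives an invariant distribution T on it: an element of G translates
    y_i by an amount depending only on the later coordinates, so that
    translation invariance on the line suffices at each stage.  Applying
    [L T = 0] to f = (y_k - x_k) a_k chi, with chi a bump function, gives
    T (a_k^2 chi) = 0, hence a_k = 0 at x.  So a_k vanishes where
    x_(k+1) = ... = x_n = 0, and Hadamard's lemma (or its polynomial analogue)
    writes it as a combination of x_(k+1), ..., x_n. *)

Set Implicit Arguments.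
Unset Strict Implicit.
Unset Printing Implicit Defensive.

Import Order.TTheory GRing.Theory Num.Theory.
Import numFieldNormedType.Exports.
Import (canonicals, coercions) mpoly.

Local Open Scope classical_set_scope.
Local Open Scope ring_scope.

(** * Smooth functions *)

(** It suffices that x_(k+1) = ... = x_n = 0. If x_k vanishes as well, the slice {y | y_l = x_l for
    l >= k} is no longer one orbit, but it is still stable under G and T is still invariant, so
    these points are reached directly and not by density.

    The factor y_k - x_k of the test function isolates a_k. It vanishes on the slice, so in sum_i T
    (d_i (a_i f)) = 0 the only product-rule term that survives is the one where d_k falls on this
    factor. The directions i < k tangent to the slice and the directions i > k drop out alike,
    without integration by parts. The factor a_k of f then turns the integrand into a square, and
    positivity concludes.

    The vanishing is proved with w frozen. Regularity in w is recovered because Hadamard's lemma is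
    applied on W x R^n as a whole, only coordinates of R^n being set to 0.

    T is an iterated one-dimensional integral, so each stage needs continuity in the variables not
    yet integrated. Integrals with parameters provide it, and they also provide the smooth quotients
    in Hadamard's lemma. *)

Section Smooth.
Context {R : realType} {n : nat}.
Implicit Types (f g : 'rV[R]_n -> R) (i : 'I_n) (x : 'rV[R]_n).
Local Notation e_ i := (delta_mx 0 i : 'rV[R]_n).

(** Smooth functions form the largest class of continuous, partially differentiable functions that
    is stable under every [partial i]. A smoothness proof thus amounts to exhibiting a stable class
    containing the function. *)
Lemma smooth_coind (C : ('rV[R]_n -> R) -> Prop) :
  (forall f, C f -> continuous f /\
     forall i, (forall x, derivable f x (e_ i)) /\ C (partial i f)) ->
  forall f, C f -> smooth f.
Proof.
move=> HC f Cf s; have Cs : C (iter_partial s f).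
  by elim: s => //= i s /HC[_ /(_ i)[]].
by have [cs ds] := HC _ Cs; split=> // i; have [] := ds i.
Qed.

Lemma smooth_continuous f : smooth f -> continuous f.
Proof. by move=> /(_ [::])[]. Qed.

Lemma smooth_derivable f i x : smooth f -> derivable f x (e_ i).
Proof. by move=> /(_ [::])[_]; apply. Qed.

Lemma smooth_partial f i : smooth f -> smooth (partial i f).
Proof.
move=> sf s; suff -> : iter_partial s (partial i f) = iter_partial (rcons s i) f.
  exact: sf.
by rewrite /iter_partial foldr_rcons.
Qed.

Lemma smooth_cst (c : R) : smooth (fun _ : 'rV[R]_n => c).
Proof.
apply: (@smooth_coind (fun f => exists c, f = fun=> c)); last by exists c.
move=> _ [d ->]; split; first exact: cst_continuous.
move=> i; split; first by move=> x; exact: derivable_cst.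
by exists 0; apply/funext => x; rewrite /partial derive_cst.
Qed.

(** Reduces directional derivatives to one real variable, so that the one-variable chain rule and
    differentiation under the integral sign apply. *)
Lemma is_derive_line f (v x : 'rV[R]_n) (d : R) :
  is_derive x v f d <-> is_derive (0 : R) 1 (fun h => f (h *: v + x)) d.
Proof.
have E : 'D_v f x = 'D_1 (fun h : R => f (h *: v + x)) 0.
  rewrite /derive; set g1 := fun h => h^-1 *: _; set g2 := fun h => h^-1 *: _.
  suff -> : g1 = g2 by [].
  by apply/funext => h; rewrite /g1 /g2 /= addr0 scale0r add0r [_%:A]mulr1.
split=> -[df dE].
  by split; [exact: (derivable1P f x v).1|rewrite -E].
by split; [exact: (derivable1P f x v).2|rewrite E].
Qed.

Lemma is_derive_coord i j x : is_derive x (e_ i) (fun y => y 0 j) ((i == j)%:R).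
Proof.
apply/is_derive_line.
have -> : (fun h : R => (h *: e_ i + x) 0 j) = fun h => h * (i == j)%:R + x 0 j.
  by apply/funext => h; rewrite !mxE eqxx /= eq_sym.
have D := is_deriveD (is_deriveM (@is_derive_id _ _ (0:R) 1)
  (is_derive_cst ((i == j)%:R : R) (0:R) 1)) (is_derive_cst (x 0 j) (0:R) 1).
apply: (is_derive_eq D).
by rewrite /= addr0 scale0r add0r [_%:A]mulr1.
Qed.

Lemma smooth_coord j : smooth (fun x : 'rV[R]_n => x 0 j).
Proof.
apply: (@smooth_coind (fun f => smooth f \/ f = fun x => x 0 j)); last by right.
move=> f [sf|->].
  split; first exact: smooth_continuous.
  move=> i; split; first by move=> x; exact: smooth_derivable.
  by left; exact: smooth_partial.
split; first exact: coord_continuous.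
move=> i; split; first by move=> x; have [] := is_derive_coord i j x.
left; suff -> : partial i (fun x => x 0 j) = fun=> (i == j)%:R by exact: smooth_cst.
apply/funext => x; exact: (@derive_val _ _ _ _ _ _ _ (is_derive_coord i j x)).
Qed.

Lemma is_derive_comp1 (h : R -> R) (dh : R) f (v : 'rV[R]_n) x (df : R) :
  is_derive (f x) 1 h dh -> is_derive x v f df ->
  is_derive x v (h \o f) (dh * df).
Proof.
move=> dh1 /is_derive_line df1; apply/is_derive_line.
apply: (@is_derive1_comp _ h (fun t : R => f (t *: v + x)) 0).
by rewrite scale0r add0r.
Qed.

Definition smooth1 (h : R -> R) := exists2 H : nat -> R -> R,
  H 0%N = h & forall k (t : R), is_derive t 1 (H k) (H k.+1 t).

(** A partial derivative of a product is a sum of products, and one of a composite is a product with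
    a new outer function. No single operation gives a class stable under [partial i], whereas the
    closure under all of them does. *)
Inductive smooth_gen : ('rV[R]_n -> R) -> Prop :=
| smooth_gen_id f of smooth f : smooth_gen f
| smooth_genD f g of smooth_gen f & smooth_gen g : smooth_gen (fun x => f x + g x)
| smooth_genM f g of smooth_gen f & smooth_gen g : smooth_gen (fun x => f x * g x)
| smooth_gen_comp h f of smooth1 h & smooth_gen f : smooth_gen (fun x => h (f x)).

Lemma smooth_gen_smooth f : smooth_gen f -> smooth f.
Proof.
apply: smooth_coind => {}f; elim => {f}.
- move=> f sf; split; first exact: smooth_continuous.
  move=> i; split; first by move=> x; exact: smooth_derivable.
  by apply: smooth_gen_id; exact: smooth_partial.
- move=> f g gf [cf df] gg [cg dg]; split.
    by move=> x; exact: (cvgD (cf x) (cg x)).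
  move=> i; split; first by move=> x; apply: derivableD; [apply (df i)|apply (dg i)].
  suff -> : partial i (fun x => f x + g x) = fun x => partial i f x + partial i g x.
    by apply: smooth_genD; [apply (df i)|apply (dg i)].
  by apply/funext => x; rewrite /partial deriveD//; [apply (df i)|apply (dg i)].
- move=> f g gf [cf df] gg [cg dg]; split.
    by move=> x; exact: (cvgM (cf x) (cg x)).
  move=> i; split; first by move=> x; apply: derivableM; [apply (df i)|apply (dg i)].
  suff -> : partial i (fun x => f x * g x) =
      fun x => f x * partial i g x + g x * partial i f x.
    apply: smooth_genD; apply: smooth_genM => //; [apply (dg i)|apply (df i)].
  by apply/funext => x; rewrite /partial deriveM//; [apply (df i)|apply (dg i)].
- move=> h f [H H0 dH] gf [cf df].
  have dhf i x : is_derive x (e_ i) (fun y => h (f y)) (H 1%N (f x) * partial i f x).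
    apply: is_derive_comp1; first by rewrite -H0; exact: dH.
    by split => //; apply (df i).
  split.
    move=> x; apply: (@continuous_comp _ _ _ f h); first exact: cf.
    apply: differentiable_continuous; apply/derivable1_diffP.
    by rewrite -H0; have [] := dH 0%N (f x).
  move=> i; split; first by move=> x; have [] := dhf i x.
  have -> : partial i (fun x => h (f x)) = fun x => H 1%N (f x) * partial i f x.
    by apply/funext => x; exact: (@derive_val _ _ _ _ _ _ _ (dhf i x)).
  apply: smooth_genM; last by apply (df i).
  apply: smooth_gen_comp => //; exists (fun k => H k.+1) => // k t; exact: dH.
Qed.

Lemma smoothD f g : smooth f -> smooth g -> smooth (fun x => f x + g x).
Proof.
by move=> sf sg; apply/smooth_gen_smooth/smooth_genD; exact: smooth_gen_id.
Qed.

Lemma smoothM f g : smooth f -> smooth g -> smooth (fun x => f x * g x).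
Proof.
by move=> sf sg; apply/smooth_gen_smooth/smooth_genM; exact: smooth_gen_id.
Qed.

Lemma smooth_comp1 h f : smooth1 h -> smooth f -> smooth (fun x => h (f x)).
Proof.
by move=> sh sf; apply/smooth_gen_smooth/smooth_gen_comp => //; exact: smooth_gen_id.
Qed.

Lemma smooth_sum (I : Type) (r : seq I) (P : pred I) (F : I -> 'rV[R]_n -> R) :
  (forall a, smooth (F a)) -> smooth (fun x => \sum_(a <- r | P a) F a x).
Proof.
move=> sF; elim: r => [|a r IHr].
  by under eq_fun do rewrite big_nil; exact: smooth_cst.
under eq_fun do rewrite big_cons; case: (P a) => //.
by apply: smoothD.
Qed.

Lemma smoothX f k : smooth f -> smooth (fun x => f x ^+ k).
Proof.
move=> sf; elim: k => [|k IHk]; first exact: smooth_cst.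
by under eq_fun do rewrite exprS; exact: smoothM.
Qed.

End Smooth.

(** * A smooth bump function *)

Section FlatFunction.
Context {R : realType}.
Implicit Types (P : {poly R}) (t u y : R).

(** The classical exp(-1/t), with a polynomial factor in 1/t that makes the family stable under
    differentiation: P becomes X^2 (P - P'). *)
Definition flat P t : R := if 0 < t then P.[t^-1] * expR (- t^-1) else 0.

Lemma exprn_expRN_le k y : 0 <= y -> y ^+ k * expR (- y) <= k`!%:R.
Proof.
move=> y0; rewrite expRN ler_pdivrMr ?expR_gt0//.
case: k => [|k].
  by rewrite expr0 fact0 mul1r; have := expR_ge1Dx y; lra.
have f0 : 0 < (k.+1)`!%:R :> R by rewrite ltr0n fact_gt0.
by rewrite mulrC -ler_pdivrMr//; apply: le_trans (expR_ge1Dxn k y0); rewrite lerDr ler01.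
Qed.

(** A quadratic bound makes the difference quotient at 0 at most C |h|, so the derivative there is
    0. With y = 1/t, the factorials come from y^(i+2) exp(-y) <= (i+2)!, two of the powers of y
    accounting for t^2. *)
Lemma flat_bound P : exists C : R, forall t, `|flat P t| <= C * t ^+ 2.
Proof.
exists (\sum_(i < size P) `|P`_i| * (i.+2)`!%:R) => t.
rewrite /flat; case: ifPn => t0; last first.
  rewrite normr0; apply: mulr_ge0; last exact: sqr_ge0.
  by apply: sumr_ge0 => i _; apply: mulr_ge0 => //; exact: ler0n.
set y := t^-1; have y0 : 0 < y by rewrite invr_gt0.
have -> : t ^+ 2 = y ^- 2 by rewrite /y exprVn invrK.
rewrite ler_pdivlMr ?exprn_gt0// horner_coef normrM (ger0_norm (expR_ge0 _)).
rewrite -mulrA.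
apply: (@le_trans _ _ (\sum_(i < size P) `|P`_i| * (y ^+ i.+2 * expR (- y)))).
  have -> : \sum_(i < size P) `|P`_i| * (y ^+ i.+2 * expR (- y)) =
      (\sum_(i < size P) `|P`_i| * y ^+ i) * (expR (- y) * y ^+ 2).
    by rewrite mulr_suml; apply: eq_bigr => i _; rewrite -addn2 exprD; ring.
  rewrite ler_wpM2r//.
    by rewrite mulr_ge0// ?expR_ge0// exprn_ge0// ltW.
  apply: (le_trans (ler_norm_sum _ _ _)); apply: ler_sum => i _.
  by rewrite normrM (ger0_norm (exprn_ge0 _ (ltW y0))).
by apply: ler_sum => i _; rewrite ler_wpM2l// exprn_expRN_le// ltW.
Qed.

Lemma is_derive_flat P t : is_derive t 1 (flat P) (flat ('X^2 * (P - P^`())) t).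
Proof.
have [t0|t0|->] := ltgtP t 0.
- rewrite /flat ltNge (ltW t0)/=.
  apply: (@near_eq_is_derive _ _ _ (cst 0)).
  by near=> s; rewrite ltNge ltW//=; near: s; exact: lt_nbhsl.
- have dV : is_derive t 1 (fun s : R => s^-1) (- t ^- 2).
    have tn0 : (t : R) != 0 by rewrite gt_eqF.
    split; first exact: derivableV.
    by rewrite deriveV//= derive_id [_%:A]mulr1.
  have dk u : is_derive u (1 : R) (fun u => P.[u] * expR (- u))
      (P^`().[u] * expR (- u) - P.[u] * expR (- u)).
    have dN := is_derive1_comp (is_derive_expR (- u)) (is_deriveNid u 1).
    have dM := is_deriveM (is_derive_poly P u) dN.
    apply: (is_derive_eq dM); rewrite /= /GRing.scale/=; ring.
  have dkV := is_derive1_comp (dk t^-1) dV.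
  apply: (@is_derive_eq _ _ _ _ _ _ _ _ (near_eq_is_derive _ dkV)).
    by near=> s; rewrite /flat ifT//; near: s; exact: lt_nbhsr.
  rewrite /flat t0 hornerM hornerXn hornerD hornerN exprVn; ring.
- rewrite /flat ltxx; have [C HC] := flat_bound P.
  suff L : h^-1 *: (flat P (h *: 1 + 0) - flat P 0) @[h --> 0^'] --> (0 : R).
    by split; [apply/cvg_ex; exists 0|apply: cvg_lim].
  have HC' h : `|h^-1 *: (flat P (h *: 1 + 0) - flat P 0)| <= C * `|h|.
    rewrite {2}/flat ltxx subr0 addr0 [_%:A]mulr1 normrM normfV.
    have [->|h0] := eqVneq h 0; first by rewrite normr0 invr0 mul0r mulr0.
    by rewrite ler_pdivrMl ?normr_gt0// mulrCA -expr2 real_normK ?num_real.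
  apply/cvgr0Pnorm_lt => e e0; near=> h.
  apply: (le_lt_trans (HC' h)); near: h; apply: nbhs_dnbhs.
  have : C * `|h| @[h --> (0 : R)] --> C * `|0 : R|.
    by apply: cvgM; [exact: cvg_cst|exact: (@norm_continuous _ R)].
  rewrite normr0 mulr0 => /cvgr0Pnorm_lt/(_ e e0).
  by apply: filterS => h; apply: le_lt_trans; exact: ler_norm.
Unshelve. all: by end_near. Qed.

Lemma smooth1_flat P : smooth1 (flat P).
Proof.
pose T Q : {poly R} := 'X^2 * (Q - Q^`()).
by exists (fun k => flat (iter k T P)) => // k t; exact: is_derive_flat.
Qed.

End FlatFunction.

Section Bump.
Context {R : realType} {n : nat}.

(** This is exp(-1/(M - |x|^2)) inside the Euclidean ball |x|^2 < M and 0 outside; [M] is the square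
    of the radius. *)
Definition bump (M : R) (x : 'rV[R]_n) : R :=
  flat 1 (M - \sum_(i < n) x 0 i ^+ 2).

Lemma smooth_bump M : smooth (bump M).
Proof.
apply: smooth_comp1; first exact: smooth1_flat.
apply: smoothD; first exact: smooth_cst.
under eq_fun do rewrite -mulN1r.
apply: smoothM; first exact: smooth_cst.
by apply: smooth_sum => i; apply: smoothX; exact: smooth_coord.
Qed.

Lemma bump_ge0 M (x : 'rV[R]_n) : 0 <= bump M x.
Proof.
by rewrite /bump /flat hornerC mul1r; case: ifP => // _; exact: expR_ge0.
Qed.

Lemma bump_gt0 M (x : 'rV[R]_n) : \sum_(i < n) x 0 i ^+ 2 < M -> 0 < bump M x.
Proof.
by move=> xM; rewrite /bump /flat subr_gt0 xM hornerC mul1r expR_gt0.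
Qed.

Lemma bump_support M (x : 'rV[R]_n) i : bump M x != 0 -> x 0 i ^+ 2 <= M.
Proof.
rewrite /bump /flat subr_gt0; case: ifPn => [xM _|_ /eqP//].
apply/ltW/(le_lt_trans _ xM); rewrite (bigD1 i)//= lerDl.
by apply: sumr_ge0 => j _; rewrite sqr_ge0.
Qed.

End Bump.

(** * Integrals over the line *)

Section LineIntegral.
Context {R : realType}.
Local Notation mu := (@lebesgue_measure R).
Implicit Types (f g : R -> R) (a b c t M C : R).

Definition lint f : R := \int[mu]_t f t.

Lemma continuous_integrable_itv f a b : continuous f ->
  mu.-integrable `[a, b] (EFin \o f).
Proof.
move=> cf; apply: continuous_compact_integrable; first exact: segment_compact.
exact: continuous_subspaceT.
Qed.

Lemma continuous_integrable_restrict f a b : continuous f ->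
  mu.-integrable setT (EFin \o (f \_ `[a, b])).
Proof.
move=> cf; rewrite -restrict_EFin.
have H := @integrable_mkcond _ _ _ mu `[a, b] (EFin \o f).
apply: (H _).1 => //.
exact: continuous_integrable_itv.
Qed.

Lemma lint_itv f a b : (forall t, t \notin `[a, b] -> f t = 0) ->
  lint f = \int[mu]_(t in `[a, b]) f t.
Proof.
move=> f0; rewrite Rintegral_mkcond /lint; congr (Rintegral _ _ _).
apply/funext => t; rewrite patchE; case: ifPn => //.
by rewrite mem_setE => /f0.
Qed.

Lemma itv_support f M t : (forall t, M < `|t| -> f t = 0) ->
  t \notin `[- M, M] -> f t = 0.
Proof. by move=> f0; rewrite in_itv/= -ler_norml -ltNge => /f0. Qed.

Lemma lintD f g c M : continuous f -> continuous g ->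
  (forall t, M < `|t| -> f t = 0) -> (forall t, M < `|t| -> g t = 0) ->
  lint (fun t => c * f t + g t) = c * lint f + lint g.
Proof.
move=> cf cg f0 g0.
have fI := itv_support f0; have gI := itv_support g0.
rewrite (lint_itv fI) (lint_itv gI) (@lint_itv _ (- M) M); last first.
  by move=> t tM; rewrite fI// gI// mulr0 addr0.
rewrite RintegralD ?RintegralZl//; try exact: continuous_integrable_itv.
apply: continuous_integrable_itv => t.
by apply: cvgM; [exact: cvg_cst|exact: cf].
Qed.

Lemma lint0 : lint (fun=> 0) = 0.
Proof. by rewrite /lint Rintegral_cst// mul0r. Qed.

Lemma lint_ge0 f : (forall t, 0 <= f t) -> 0 <= lint f.
Proof. by move=> f0; apply: Rintegral_ge0. Qed.

Lemma Rintegral_itv_cst c a b : a <= b -> \int[mu]_(_ in `[a, b]) c = c * (b - a).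
Proof.
move=> ab; rewrite Rintegral_cst//= lebesgue_measure_itv/= lte_fin.
by case: ltgtP ab => // ->; rewrite subrr.
Qed.

Lemma normr_lint_itv_le f a b C : a <= b -> continuous f ->
  (forall t, a <= t <= b -> `|f t| <= C) ->
  `|\int[mu]_(t in `[a, b]) f t| <= C * (b - a).
Proof.
move=> ab cf fC; rewrite -Rintegral_itv_cst//.
apply: (le_trans (le_normr_Rintegral _ _)) => //.
  exact: continuous_integrable_itv.
apply: le_Rintegral => //.
- by apply: continuous_integrable_itv => t; apply: cvg_norm; exact: cf.
- by apply: continuous_integrable_itv => t; exact: cvg_cst.
Qed.

Lemma normr_lint_le f C M : 0 <= M -> continuous f ->
  (forall t, M < `|t| -> f t = 0) -> (forall t, `|f t| <= C) ->
  `|lint f| <= C * (M *+ 2).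
Proof.
move=> M0 cf f0 fC; rewrite (@lint_itv _ (- M) M); last first.
  by move=> t /itv_support ->.
apply: le_trans (normr_lint_itv_le (C := C) _ cf _) _ => //; first lra.
by rewrite opprK mulr2n.
Qed.

Lemma lint_gt0 f M t : continuous f -> (forall s, M < `|s| -> f s = 0) ->
  (forall s, 0 <= f s) -> 0 < f t -> 0 < lint f.
Proof.
move=> cf f0 fge0 ft.
have /cvgrPdist_lt/(_ (f t / 2)) : f s @[s --> t] --> f t by exact: cf.
case=> [|d /= d0 Hd]; first lra.
set c := f t / 2; set e := d / 2.
have Jle s : t - e <= s <= t + e -> c <= f s.
  move=> ste; have : `|t - s| < d by rewrite ltr_norml /e in ste *; lra.
  by move/Hd; rewrite /= ltr_norml /c; lra.
apply: (@lt_le_trans _ _ (\int[mu]_(_ in `[t - e, t + e]) c)).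
  by rewrite Rintegral_itv_cst ?mulr_gt0 /c /e; lra.
rewrite Rintegral_mkcond; apply: le_Rintegral => //=.
- by apply: continuous_integrable_restrict => s; exact: cvg_cst.
- have -> : f = f \_ `[- M, M].
    apply/funext => s; rewrite patchE; case: ifPn => //.
    by rewrite mem_setE => /(itv_support f0).
  exact: continuous_integrable_restrict.
- move=> s _; rewrite patchE; case: ifPn => // .
  by rewrite mem_setE in_itv/=; exact: Jle.
Qed.

Lemma lint_shift f M c : continuous f -> (forall s, M < `|s| -> f s = 0) ->
  lint (fun t => f (t + c)) = lint f.
Proof.
move=> cf f0.
(* [M] may be zero or negative; N > 0 keeps the interval of the substitution nondegenerate. *)
pose N := `|M| + 1.
have N0 : 0 < N by rewrite /N; have := normr_ge0 M; lra.
have MN : M <= N by rewrite /N; have := ler_norm M; lra.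
have f0' t : N < `|t| -> f t = 0 by move=> tN; apply: f0; exact: le_lt_trans tN.
rewrite (@lint_itv _ (- N - c) (N - c)); last first.
  move=> t H; apply: (itv_support f0'); move: H.
  by rewrite !in_itv/= lerBlDr lerBrDr.
rewrite (@lint_itv f (- N) N); last by move=> t /itv_support ->.
rewrite /Rintegral; congr fine; symmetry.
have dF (x : R) : is_derive x 1 (fun t => t + c) 1.
  by apply: is_derive_eq (is_deriveD (is_derive_id x 1) (is_derive_cst c x 1)) _; rewrite addr0.
have F1 : derive1 (fun t : R => t + c) = (fun=> 1).
  by apply/funext => x; rewrite derive1E derive_val.
have := @integration_by_substitution_increasing R (fun t => t + c) f (- N - c) (N - c).
rewrite !subrK F1 => ->; last first.
- exact: continuous_subspaceT.
- split; first by move=> x _; have [] := dF x.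
    by apply: cvg_at_right_filter; apply: cvgD; [exact: cvg_id|exact: cvg_cst].
  by apply: cvg_at_left_filter; apply: cvgD; [exact: cvg_id|exact: cvg_cst].
- exact: is_cvg_cst.
- exact: is_cvg_cst.
- by move=> x _; exact: cvg_cst.
- by move=> x y _ _; rewrite ltrD2r.
- lra.
by apply: eq_integral => x _ /=; rewrite /GRing.mul_fun/= mulr1.
Qed.

End LineIntegral.

(** * Integrals with parameters *)

Lemma row_continuous {R : realType} (T : topologicalType) n
    (F : T -> 'rV[R]_n) :
  (forall j, continuous (fun t => F t 0 j)) -> continuous F.
Proof.
move=> cF.
have -> : F = fun t => \sum_j F t 0 j *: delta_mx 0 j.
  by apply/funext => t; exact: row_sum_delta.
move=> t; rewrite /continuous_at.
apply: cvg_big => [|j _].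
  by move=> p; exact: add_continuous.
by apply: cvgZl; exact: cF.
Qed.

Section ParametricIntegral.
Context {R : realType}.
Local Notation mu := (@lebesgue_measure R).
Implicit Types (a b s : R).

Lemma continuous_pair_snd (T : topologicalType) (G : T -> R -> R) z :
  continuous (fun p : T * R => G p.1 p.2) -> continuous (G z).
Proof.
move=> cG s; apply: (@continuous_comp _ _ _ (pair z) (fun p => G p.1 p.2)).
  by apply: (cvg_pair (G := nbhs z) (H := nbhs s)); [exact: cvg_cst|exact: cvg_id].
exact: cG.
Qed.

(** By compactness of [a, b], G z' tends to G z uniformly on [a, b] as z' tends to z. *)
Lemma continuous_param_integral (T : topologicalType) (G : T -> R -> R) a b :
  a <= b -> continuous (fun p : T * R => G p.1 p.2) ->
  continuous (fun z => \int[mu]_(s in `[a, b]) G z s).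
Proof.
move=> ab cG z; apply/cvgrPdist_le => e e0.
(* The summand 1 keeps the denominator positive when a = b. *)
pose d := e / (b - a + 1).
have d0 : 0 < d by rewrite divr_gt0//; lra.
have : \forall z' \near z, `[a, b] `<=` (fun s => `|G z s - G z' s| <= d).
  have /compact_near_coveringP := @segment_compact R a b.
  apply=> s _.
  have /cvgrPdist_lt/(_ (d / 2)) H1 := cG (z, s).
  have /cvgrPdist_lt/(_ (d / 2)) H2 := @continuous_pair_snd _ G z cG s.
  have {}H1 := H1 ltac:(lra); have {}H2 := H2 ltac:(lra).
  case: H1 => -[A B] /= [zA sB] AB.
  exists (B `&` (fun t => `|G z s - G z t| < d / 2), A).
    by split => //=; apply: filterI.
  move=> [t z'] /= [[tB Ht] z'A].
  have := AB (z', t); move=> /(_ (conj z'A tB))/= H.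
  have -> : G z t - G z' t = (G z s - G z' t) - (G z s - G z t) by ring.
  by apply: (le_trans (ler_normB _ _)); lra.
apply: filterS => z' Hz'.
rewrite -RintegralB//; try exact/continuous_integrable_itv/continuous_pair_snd.
apply: (@le_trans _ _ (d * (b - a))).
  apply: normr_lint_itv_le => // t.
  by apply: cvgB; exact: continuous_pair_snd.
rewrite /d mulrAC ler_pdivrMr; last by lra.
rewrite ler_pM2l//; lra.
Qed.

(** The dominating function is a constant, obtained from the boundedness of [dG] on the compact set
    [-1, 1] x [a, b]. The derivative at 0 is enough, since [is_derive_line] moves every base point
    to 0. *)
Lemma is_derive_param_integral (G dG : R -> R -> R) a b :
  continuous (fun p : R * R => dG p.1 p.2) ->
  (forall h, continuous (G h)) ->
  (forall h s : R, is_derive h 1 (G^~ s) (dG h s)) ->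
  is_derive (0 : R) 1 (fun h => \int[mu]_(s in `[a, b]) G h s)
    (\int[mu]_(s in `[a, b]) dG 0 s).
Proof.
move=> cdG cG dGP.
have d1 (h s : R) : partial1of2 G h s = dG h s.
  by rewrite partial1of2E; exact: (@derive_val _ _ _ _ _ _ _ (dGP h s)).
pose I : set R := [set` `]-1, 1[%R]; pose J : set R := [set` `[a, b]].
have [M HM] : exists M : R, forall h s : R, I h -> J s -> `|dG h s| <= M.
  pose K : set (R * R) := `[-1, 1] `*` `[a, b].
  have cK : compact ((fun p : R * R => dG p.1 p.2) @` K).
    apply: continuous_compact; first exact: continuous_subspaceT.
    by apply: compact_setX; exact: segment_compact.
  have [M [_ HM]] := compact_bounded cK.
  exists (M + 1) => h s h1 sab; apply: (HM (M + 1)); first lra.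
  by exists (h, s) => //; split => //=; by move: h1; rewrite /I /= !in_itv/=; lra.
have I0 : I 0 by rewrite /I /= in_itv/=; lra.
have iG (h : R) : I h -> mu.-integrable `[a, b] (EFin \o G h).
  by move=> _; exact: continuous_integrable_itv.
have dG1 (h s : R) : I h -> J s -> derivable (G^~ s) h 1.
  by move=> _ _; have [] := dGP h s.
have M0 (s : R) : 0 <= `|M| by [].
have iM : mu.-integrable `[a, b] (EFin \o (fun=> `|M|)).
  by apply: continuous_integrable_itv => s; exact: cvg_cst.
have bM (h s : R) : I h -> J s -> `|partial1of2 G h s| <= `|M|.
  by move=> h1 s1; rewrite d1; apply: (le_trans (HM _ _ h1 s1)); exact: ler_norm.
have mI : measurable ([set` `[a, b]] : set (measurableTypeR R)) by [].
split; first exact: (derivable_under_integral mI I0 iG dG1 M0 iM bM).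
rewrite -derive1E (differentiation_under_integral mI I0 iG dG1 M0 iM bM).
by apply: eq_Rintegral => s _; rewrite d1.
Qed.

End ParametricIntegral.

(** * Hadamard's lemma *)

Section Hadamard.
Context {R : realType} {N : nat}.
Local Notation mu := (@lebesgue_measure R).
Implicit Types (f b : 'rV[R]_N -> R) (c : 'I_N -> R -> R) (m : R -> R)
  (z : 'rV[R]_N) (P : pred 'I_N).
Local Notation e_ i := (delta_mx 0 i : 'rV[R]_N).

(** [is_derive_line] only speaks of the parameter 0; composing with u - t reaches an arbitrary
    parameter t. *)
Lemma is_derive_smooth_line f i z (t : R) : smooth f ->
  is_derive t 1 (fun u => f (u *: e_ i + z)) (partial i f (t *: e_ i + z)).
Proof.
move=> sf; have dt : is_derive (t *: e_ i + z) (e_ i) f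
    (partial i f (t *: e_ i + z)).
  by split; first exact: smooth_derivable.
move/is_derive_line in dt.
have d1 : is_derive t 1 (fun u => u - t) 1.
  by apply: (is_derive_eq (is_deriveB (is_derive_id t 1) (is_derive_cst t t 1)));
    rewrite subr0.
pose g (h : R) := f (h *: e_ i + (t *: e_ i + z)).
have dg : is_derive (t - t) 1 g (partial i f (t *: e_ i + z)) by rewrite subrr.
have -> : (fun u => f (u *: e_ i + z)) = g \o (fun u => u - t).
  by apply/funext => u; rewrite /g /= addrA -scalerDl subrK.
rewrite -[partial _ _ _]mulr1.
exact: (@is_derive1_comp _ _ (fun u => u - t)).
Qed.

Definition scale_coords c (s : R) z : 'rV[R]_N := \row_l (c l s * z 0 l).

(** The weight [m] makes these means stable under differentiation: d_i produces the factor c_i(s),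
    which is absorbed into [m], and replaces [b] by its partial derivative. [smooth_coind] then
    applies. *)
Definition weighted_mean c m b z : R :=
  \int[mu]_(s in `[0, 1]) (m s * b (scale_coords c s z)).

Lemma scale_coords_continuous c : (forall l, continuous (c l)) ->
  continuous (fun p : 'rV[R]_N * R => scale_coords c p.2 p.1).
Proof.
move=> cc; apply: row_continuous => j.
have -> : (fun t : 'rV[R]_N * R => scale_coords c t.2 t.1 0 j) =
    (fun t => c j t.2 * t.1 0 j) by apply/funext => t; rewrite mxE.
move=> p; apply: cvgM.
  by apply: (@continuous_comp _ _ _ snd (c j)); [exact: cvg_snd|exact: cc].
apply: (@continuous_comp _ _ _ fst (fun x : 'rV[R]_N => x 0 j)).
  exact: cvg_fst.
exact: coord_continuous.
Qed.

Lemma weighted_continuous c m b : (forall l, continuous (c l)) ->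
  continuous m -> continuous b ->
  continuous (fun p : 'rV[R]_N * R => m p.2 * b (scale_coords c p.2 p.1)).
Proof.
move=> cc cm cb p; apply: cvgM.
  by apply: (@continuous_comp _ _ _ snd m); [exact: cvg_snd|exact: cm].
apply: (@continuous_comp _ _ _ (fun p : 'rV[R]_N * R => scale_coords c p.2 p.1) b).
  exact: scale_coords_continuous.
exact: cb.
Qed.

Lemma scale_coords_line c i s (h : R) z :
  scale_coords c s (h *: e_ i + z) = (h * c i s) *: e_ i + scale_coords c s z.
Proof.
apply/rowP => l; rewrite !mxE eqxx/= mulrDr; congr (_ + _).
by have [->|_] := eqVneq l i; rewrite ?mulr1 ?mulr0 // mulrC.
Qed.

Lemma is_derive_weighted_mean c m b i z : (forall l, continuous (c l)) ->
  continuous m -> smooth b ->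
  is_derive z (e_ i) (weighted_mean c m b)
    (weighted_mean c (fun s => m s * c i s) (partial i b) z).
Proof.
move=> cc cm sb; apply/is_derive_line.
pose q (h : R) := h *: e_ i + z.
have cq : continuous q.
  by move=> h; apply: cvgD; [apply: cvgZl; exact: cvg_id|exact: cvg_cst].
have cG m' b' : continuous m' -> continuous b' ->
    continuous (fun p : R * R => m' p.2 * b' (scale_coords c p.2 (q p.1))).
  move=> cm' cb' p.
  apply: (@continuous_comp _ _ _ (fun p : R * R => (q p.1, p.2))
    (fun p : 'rV[R]_N * R => m' p.2 * b' (scale_coords c p.2 p.1))).
    apply: (cvg_pair (G := nbhs (q p.1)) (H := nbhs p.2)); last exact: cvg_snd.
    by apply: (@continuous_comp _ _ _ fst q); [exact: cvg_fst|exact: cq].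
  exact: weighted_continuous.
have -> : weighted_mean c (fun s => m s * c i s) (partial i b) z =
    \int[mu]_(s in `[0, 1]) (m s * c i s * partial i b (scale_coords c s (q 0))).
  by rewrite /weighted_mean /q scale0r add0r.
apply: (@is_derive_param_integral _ (fun h s => m s * b (scale_coords c s (q h)))
  (fun h s => m s * c i s * partial i b (scale_coords c s (q h)))).
- apply: (cG (fun s => m s * c i s)).
    by move=> s; apply: cvgM; [exact: cm|exact: cc].
  exact/smooth_continuous/smooth_partial.
- move=> h; apply: (@continuous_pair_snd _ _ (fun h s => m s * b (scale_coords c s (q h)))).
  by apply: cG => //; exact: smooth_continuous.
move=> h s.
have -> : (fun h => m s * b (scale_coords c s (q h))) =
    (fun h => m s *: b ((h * c i s) *: e_ i + scale_coords c s z)).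
  by apply/funext => u; rewrite /q scale_coords_line.
have d1 := is_derive_smooth_line i (scale_coords c s z) (h * c i s) sb.
have d2 : is_derive h 1 (fun h => h * c i s) (c i s).
  apply: (is_derive_eq (is_deriveM (is_derive_id h 1) (is_derive_cst (c i s) h 1))).
  by rewrite scaler0 add0r [_%:A]mulr1.
have D := is_deriveZ (m s)
  (@is_derive1_comp _ _ (fun u => u * c i s) h _ _ d1 d2).
apply: (is_derive_eq D).
by rewrite /q scale_coords_line /GRing.scale/= mulrCA mulrC.
Qed.

Lemma smooth_weighted_mean c m b : (forall l, continuous (c l)) ->
  continuous m -> smooth b -> smooth (weighted_mean c m b).
Proof.
move=> cc cm sb.
apply: (@smooth_coind _ _ (fun f => exists m b,
  [/\ continuous m, smooth b & f = weighted_mean c m b])); last by exists m, b.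
move=> _ [{}m [{}b [{}cm {}sb ->]]]; split.
  apply: continuous_param_integral; first exact: ler01.
  by apply: weighted_continuous => //; exact: smooth_continuous.
move=> i; split => [z|]; first by have [] := is_derive_weighted_mean i z cc cm sb.
exists (fun s => m s * c i s), (partial i b); split.
- by move=> s; apply: cvgM; [exact: cm|exact: cc].
- exact: smooth_partial.
- apply/funext => z; have dz := is_derive_weighted_mean i z cc cm sb.
  exact: (@derive_val _ _ _ _ _ _ _ dz).
Qed.

Definition zero_coords P z : 'rV[R]_N := \row_l (if P l then 0 else z 0 l).

(** Coordinates are set to 0 one at a time. Once those of [r] are 0, letting z_j shrink to 0 changes
    f by z_j times the integral over [0, 1] of d_j f along the segment, by the fundamental theorem
    of calculus. The factors [c] below parametrize that segment. *)
Lemma smooth_Hadamard_seq f (r : seq 'I_N) : smooth f -> uniq r ->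
  exists2 phi : 'I_N -> 'rV[R]_N -> R, (forall j, smooth (phi j)) &
    forall z, f z = f (zero_coords (mem r) z) + \sum_(j <- r) z 0 j * phi j z.
Proof.
move=> sf; elim: r => [_|j r IHr /= /andP[jr /IHr[phi sphi phiE]]].
  exists (fun _ _ => 0) => [_|z]; first exact: smooth_cst.
  rewrite big_nil addr0; congr f; apply/rowP => l; by rewrite !mxE.
pose c (l : 'I_N) (s : R) : R := if l \in r then 0 else if l == j then s else 1.
have cc l : continuous (c l).
  rewrite /c; case: (l \in r); first by move=> s; exact: cvg_cst.
  by case: (l == j) => s; [exact: cvg_id|exact: cvg_cst].
pose psi := weighted_mean c (fun=> 1) (partial j f).
have spsi : smooth psi.
  apply: smooth_weighted_mean => //; first by move=> s; exact: cvg_cst.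
  exact: smooth_partial.
(* As j does not occur in [r], redefining the function of index j leaves the earlier terms of the
   sum unchanged. *)
exists (fun l => if l == j then psi else phi l).
  by move=> l; case: ifP.
move=> z; rewrite phiE big_cons eqxx addrA.
rewrite [in RHS](eq_big_seq (fun l => z 0 l * phi l z)); last first.
  by move=> l lr; case: eqP => // lj; rewrite -lj lr in jr.
congr (_ + _).
pose y := zero_coords (mem (j :: r)) z.
have cE s : scale_coords c s z = (s * z 0 j) *: e_ j + y.
  apply/rowP => l; rewrite !mxE /c !inE eqxx/=.
  case: (eqVneq l j) => [->|lj] /=.
    by rewrite (negbTE jr) mulr1 addr0.
  by rewrite mulr0 add0r; case: ifP; rewrite ?mul0r ?mul1r.
have -> : zero_coords (mem r) z = (1 * z 0 j) *: e_ j + y.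
  rewrite -cE; apply/rowP => l; rewrite !mxE /c/=.
  by case: (l \in r); rewrite ?mul0r//; case: eqP => _; rewrite mul1r.
pose F (s : R) := f ((s * z 0 j) *: e_ j + y).
have dF (s : R) : is_derive s 1 F (z 0 j * partial j f (scale_coords c s z)).
  have d1 := is_derive_smooth_line j y (s * z 0 j) sf.
  have d2 : is_derive s 1 (fun h => h * z 0 j) (z 0 j).
    apply: (is_derive_eq (is_deriveM (is_derive_id s 1) (is_derive_cst (z 0 j) s 1))).
    by rewrite scaler0 add0r [_%:A]mulr1.
  by apply: (is_derive_eq (@is_derive1_comp _ _ (fun u => u * z 0 j) s _ _ d1 d2)); rewrite cE mulrC.
have cF : continuous F.
  by move=> s; apply/differentiable_continuous/derivable1_diffP; have [] := dF s.
have cg : continuous (fun s => partial j f (scale_coords c s z)).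
  have H := @weighted_continuous c (fun=> 1) (partial j f) cc.
  have {}H : continuous (fun p : 'rV[R]_N * R => partial j f (scale_coords c p.2 p.1)).
    under eq_fun do rewrite -[partial _ _ _]mul1r; apply: H.
      by move=> s; exact: cvg_cst.
    exact/smooth_continuous/smooth_partial.
  exact: (@continuous_pair_snd _ _ (fun z s => partial j f (scale_coords c s z))).
have := @continuous_FTC2 R (fun s => z 0 j * partial j f (scale_coords c s z)) F 0 1 ltr01.
have -> : z 0 j * psi z =
    \int[mu]_(s in `[0, 1]) (z 0 j * partial j f (scale_coords c s z)).
  rewrite RintegralZl//; last exact: continuous_integrable_itv.
  by congr (_ * _); apply: eq_Rintegral => s _; rewrite mul1r.
rewrite /Rintegral => ->.
- by rewrite /F mul0r scale0r add0r /=; ring.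
- by apply: continuous_subspaceT => s; apply: cvgM; [exact: cvg_cst|exact: cg].
- split; first by move=> s _; have [] := dF s.
    exact/cvg_at_right_filter/cF.
  exact/cvg_at_left_filter/cF.
- by move=> s _; rewrite derive1E; exact: (@derive_val _ _ _ _ _ _ _ (dF s)).
Qed.

Lemma smooth_Hadamard f P : smooth f ->
  exists2 phi : 'I_N -> 'rV[R]_N -> R, (forall j, smooth (phi j)) &
    forall z, f z = f (zero_coords P z) + \sum_(j | P j) z 0 j * phi j z.
Proof.
move=> sf; have [phi sphi phiE] := smooth_Hadamard_seq sf (enum_uniq P).
exists phi => // z; rewrite {1}phiE big_enum/=; congr (f _ + _).
by apply/rowP => l; rewrite !mxE/= mem_enum.
Qed.

(** * Polynomial functions and their version of Hadamard's lemma *)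

Definition polyfun f := exists p : mpoly.mpoly N R,
  forall z, f z = mpoly.meval (fun k => z 0 k) p.

Lemma polyfun_cst (a : R) : polyfun (fun=> a).
Proof. by exists (mpoly.mpolyC N a) => z; rewrite mpoly.mevalC. Qed.

Lemma polyfun_coord i : polyfun (fun z => z 0 i).
Proof.
by exists (mpoly.mpolyX R (mpoly.mnm1 i)) => z; rewrite mpoly.mevalXU.
Qed.

Lemma polyfunD f g : polyfun f -> polyfun g -> polyfun (fun z => f z + g z).
Proof.
by move=> [p pE] [q qE]; exists (p + q) => z; rewrite mpoly.mevalD pE qE.
Qed.

Lemma polyfunM f g : polyfun f -> polyfun g -> polyfun (fun z => f z * g z).
Proof.
by move=> [p pE] [q qE]; exists (p * q) => z; rewrite mpoly.mevalM pE qE.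
Qed.

Lemma polyfun_ind (C : ('rV[R]_N -> R) -> Prop) :
  (forall a, C (fun=> a)) -> (forall i, C (fun z => z 0 i)) ->
  (forall f g, C f -> C g -> C (fun z => f z + g z)) ->
  (forall f g, C f -> C g -> C (fun z => f z * g z)) ->
  forall f, polyfun f -> C f.
Proof.
move=> Ccst Ccoord CD CM f [p fE].
have -> : f = fun z => \sum_(m <- mpoly.msupp p)
    mpoly.mcoeff m p * \prod_(i < N) z 0 i ^+ m i.
  by apply/funext => z; rewrite fE mpoly.mevalE.
elim: (mpoly.msupp p) => [|m r IHr].
  by under eq_fun do rewrite big_nil.
under eq_fun do rewrite big_cons; apply: (CD) => //; apply: (CM) => //.
elim: (index_enum _) => [|i s IHs].
  by under eq_fun do rewrite big_nil.
under eq_fun do rewrite big_cons; apply: (CM) => //.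
elim: (m i) => [|k IHk]; first by under eq_fun do rewrite expr0.
by under eq_fun do rewrite exprS; exact: CM.
Qed.

Lemma polyfun_smooth f : polyfun f -> smooth f.
Proof.
apply: polyfun_ind; [exact: smooth_cst|exact: smooth_coord|exact: smoothD|].
exact: smoothM.
Qed.

Lemma polyfun_zero_coords f P : polyfun f -> polyfun (f \o zero_coords P).
Proof.
apply: (@polyfun_ind (fun f => polyfun (f \o zero_coords P))) => {f}.
- exact: polyfun_cst.
- move=> i; have -> : (fun z => z 0 i) \o zero_coords P =
      fun z => if P i then 0 else z 0 i by apply/funext => z; rewrite /= mxE.
  by case: (P i); [exact: polyfun_cst|exact: polyfun_coord].
- by move=> f g; exact: polyfunD.
- by move=> f g; exact: polyfunM.
Qed.

Lemma polyfun_Hadamard f P : polyfun f ->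
  exists2 phi : 'I_N -> 'rV[R]_N -> R, (forall j, polyfun (phi j)) &
    forall z, f z = f (zero_coords P z) + \sum_(j | P j) z 0 j * phi j z.
Proof.
(* The induction carries [polyfun f] along, because in the product case the factors themselves enter
   the new quotients. *)
move=> pf; suff [] : polyfun f /\ exists2 phi : 'I_N -> 'rV[R]_N -> R,
    (forall j, polyfun (phi j)) &
    forall z, f z = f (zero_coords P z) + \sum_(j | P j) z 0 j * phi j z by [].
move: f pf; apply: polyfun_ind.
- move=> a; split; first exact: polyfun_cst.
  exists (fun _ _ => 0) => [_|z]; first exact: polyfun_cst.
  by rewrite big1 ?addr0// => j _; rewrite mulr0.
- move=> i; split; first exact: polyfun_coord.
  exists (fun j _ => (j == i)%:R) => [j|z]; first exact: polyfun_cst.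
  rewrite mxE; case: ifPn => Pi.
    rewrite add0r (bigD1 i)//= eqxx mulr1 big1 ?addr0// => j /andP[_ /negbTE->].
    by rewrite mulr0.
  rewrite big1 ?addr0// => j Pj; case: eqP => [ji|]; last by rewrite mulr0.
  by rewrite -ji Pj in Pi.
- move=> f g [pf [phi pphi phiE]] [pg [psi ppsi psiE]].
  split; first exact: polyfunD.
  exists (fun j z => phi j z + psi j z) => [j|z]; first exact: polyfunD.
  rewrite phiE psiE addrACA -big_split/=; congr (_ + _).
  by apply: eq_bigr => j _; rewrite mulrDr.
- move=> f g [pf [phi pphi phiE]] [pg [psi ppsi psiE]].
  split; first exact: polyfunM.
  (* With z' = [zero_coords P z], this comes from f(z) g(z) - f(z') g(z') = (f(z) - f(z')) g(z) +
     f(z') (g(z) - g(z')). *)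
  exists (fun j z => phi j z * g z + f (zero_coords P z) * psi j z) => [j|z].
    apply: polyfunD; apply: polyfunM => //.
    exact: (@polyfun_zero_coords f).
  under eq_bigr => j _ do rewrite mulrDr mulrA (mulrCA (z 0 j)).
  rewrite big_split/= -mulr_suml -mulr_sumr.
  by rewrite addrCA -mulrDr -psiE {1}phiE mulrDl addrC.
Qed.

End Hadamard.

(** * Integrals over orbits *)

Section OrbitIntegral.
Context {R : realType} {n : nat}.
Implicit Types (F G : 'rV[R]_n -> R) (x y : 'rV[R]_n) (k l : nat) (t M : R)
  (i j : 'I_n).

Definition set_coord x k t : 'rV[R]_n := \row_i (if i == k :> nat then t else x 0 i).

(** Indices start at 0: coordinates 0, ..., k-1 are integrated, k-1 outermost, and those from k on
    keep their values in x. Inside each integral the later coordinates are fixed, so G acts on the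
    variable of integration by a translation. *)
Fixpoint orbit_int k F x : R :=
  if k is l.+1 then lint (fun t => orbit_int l F (set_coord x l t)) else F x.

Definition agree_from k x y := forall i, (k <= i)%N -> x 0 i = y 0 i.

Definition support_from k M F :=
  forall x i, (k <= i)%N -> M < `|x 0 i| -> F x = 0.

Lemma set_coord_id x i : set_coord x i (x 0 i) = x.
Proof. by apply/rowP => j; rewrite mxE; case: eqP => // /val_inj ->. Qed.

Lemma set_coord_ord x i t : set_coord x i t 0 i = t.
Proof. by rewrite mxE eqxx. Qed.

Lemma set_coord_gt x k t i : (k < i)%N -> set_coord x k t 0 i = x 0 i.
Proof. by move=> ki; rewrite mxE gtn_eqF. Qed.

Lemma set_coord_continuous k :
  continuous (fun p : 'rV[R]_n * R => set_coord p.1 k p.2).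
Proof.
apply: row_continuous => j.
have -> : (fun p : 'rV[R]_n * R => set_coord p.1 k p.2 0 j) =
    (fun p => if j == k :> nat then p.2 else p.1 0 j).
  by apply/funext => p; rewrite mxE.
case: (_ == _) => p; first exact: cvg_snd.
apply: (@continuous_comp _ _ _ fst (fun x : 'rV[R]_n => x 0 j)).
  exact: cvg_fst.
exact: coord_continuous.
Qed.

Lemma eq_orbit_int k F G x :
  (forall y, agree_from k y x -> F y = G y) -> orbit_int k F x = orbit_int k G x.
Proof.
elim: k x => [|k IHk] x FG /=; first exact: FG.
congr lint; apply/funext => t; apply: IHk => y yx; apply: FG => i ki.
by rewrite yx 1?ltnW// set_coord_gt.
Qed.

Lemma orbit_int_agree k F x y :
  agree_from k x y -> orbit_int k F x = orbit_int k F y.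
Proof.
elim: k x y => [|k IHk] x y xy /=; first by congr F; apply/rowP => i; exact: xy.
congr lint; apply/funext => t; apply: IHk => i; rewrite leq_eqVlt !mxE eq_sym.
by case: eqP => //= _; exact: xy.
Qed.

Lemma support_from_set_coord k M F x t (kn : (k < n)%N) :
  support_from k M F -> M < `|t| -> F (set_coord x k t) = 0.
Proof.
move=> F0 Mt; apply: (F0 _ (Ordinal kn)); first by [].
by rewrite (set_coord_ord _ (Ordinal kn)).
Qed.

Lemma orbit_int_support k M F : support_from 0 M F ->
  support_from k M (orbit_int k F).
Proof.
move=> F0; elim: k => [//|k IHk] x i ki Mx /=.
rewrite -[RHS]lint0; congr lint; apply/funext => t.
by apply: (IHk _ i); [exact: ltnW|rewrite set_coord_gt].
Qed.

(** The support condition replaces the line by the fixed segment [-M, M], where the continuity of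
    integrals with parameters is available. *)
Lemma orbit_int_continuous k M F : (k <= n)%N -> 0 <= M -> continuous F ->
  support_from 0 M F -> continuous (orbit_int k F).
Proof.
move=> kn M0 cF F0; elim: k kn => [//|k IHk] kn.
have -> : orbit_int k.+1 F = fun x => \int[lebesgue_measure]_(t in `[- M, M])
    orbit_int k F (set_coord x k t).
  apply/funext => x; apply: lint_itv => t.
  apply: (itv_support (f := fun t => orbit_int k F (set_coord x k t))) => {}t.
  exact/support_from_set_coord/orbit_int_support.
apply: continuous_param_integral; first lra.
move=> p; apply: (@continuous_comp _ _ _
  (fun p : 'rV[R]_n * R => set_coord p.1 k p.2) (orbit_int k F)).
  exact: set_coord_continuous.
exact: IHk (ltnW kn) _.
Qed.

Lemma orbit_int_section_continuous k M F x : (k <= n)%N -> 0 <= M ->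
  continuous F -> support_from 0 M F ->
  continuous (fun t => orbit_int k F (set_coord x k t)).
Proof.
move=> kn M0 cF F0.
apply: (@continuous_pair_snd _ _ (fun x t => orbit_int k F (set_coord x k t))).
move=> p; apply: (@continuous_comp _ _ _
  (fun p : 'rV[R]_n * R => set_coord p.1 k p.2) (orbit_int k F)).
  exact: set_coord_continuous.
exact: orbit_int_continuous M0 cF F0 _.
Qed.

Lemma orbit_int_section_support k M F x t : (k < n)%N ->
  support_from 0 M F -> M < `|t| -> orbit_int k F (set_coord x k t) = 0.
Proof.
by move=> kn F0; exact/support_from_set_coord/orbit_int_support.
Qed.

Lemma orbit_intD k M F G (c : R) x : (k <= n)%N -> 0 <= M ->
  continuous F -> continuous G -> support_from 0 M F -> support_from 0 M G ->
  orbit_int k (fun x => c * F x + G x) x = c * orbit_int k F x + orbit_int k G x.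
Proof.
move=> kn M0 cF cG F0 G0; elim: k x kn => [//|k IHk] x kn /=.
under eq_fun do rewrite IHk ?(ltnW kn)//.
apply: (@lintD _ _ _ c M).
- exact: orbit_int_section_continuous (ltnW kn) M0 cF F0.
- exact: orbit_int_section_continuous (ltnW kn) M0 cG G0.
- by move=> t; exact: orbit_int_section_support.
- by move=> t; exact: orbit_int_section_support.
Qed.

Lemma orbit_int0 k x : orbit_int k (fun=> 0) x = 0.
Proof.
elim: k x => [//|k IHk] x /=; under eq_fun do rewrite IHk.
exact: lint0.
Qed.

Lemma orbit_int_ge0 k F x : (forall y, 0 <= F y) -> 0 <= orbit_int k F x.
Proof.
by move=> F0; elim: k x => [//|k IHk] x /=; apply: lint_ge0 => t; exact: IHk.
Qed.

Lemma orbit_int_gt0 k M F x : (k <= n)%N -> 0 <= M -> continuous F ->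
  support_from 0 M F -> (forall y, 0 <= F y) -> 0 < F x -> 0 < orbit_int k F x.
Proof.
move=> kn M0 cF F0 Fge0 Fx; elim: k kn => [//|k IHk] kn /=.
(* At this value of the variable [set_coord] gives back x, where the induction hypothesis yields
   positivity. *)
apply: (@lint_gt0 _ _ M (x 0 (Ordinal kn))).
- exact: orbit_int_section_continuous (ltnW kn) M0 cF F0.
- by move=> t; exact: orbit_int_section_support.
- by move=> t; exact: orbit_int_ge0.
- by rewrite (set_coord_id x (Ordinal kn)) IHk// ltnW.
Qed.

Lemma normr_orbit_int_le k M F (C : R) x : (k <= n)%N -> 0 <= M ->
  continuous F -> support_from 0 M F -> (forall y, `|F y| <= C) ->
  `|orbit_int k F x| <= C * (M *+ 2) ^+ k.
Proof.
move=> kn M0 cF F0 FC; elim: k x kn => [|k IHk] x kn /=.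
  by rewrite expr0 mulr1.
rewrite exprSr mulrA; apply: normr_lint_le => //.
- exact: orbit_int_section_continuous (ltnW kn) M0 cF F0.
- by move=> t; exact: orbit_int_section_support.
- by move=> t; exact: IHk (ltnW kn).
Qed.

Lemma mx_actE (g : 'M[R]_n) x i : mx_act g x 0 i = \sum_j x 0 j * g i j.
Proof. by rewrite mxE; apply: eq_bigr => j _; rewrite mxE. Qed.

Lemma mx_act_unipotent (g : 'M[R]_n) x i : unipotent_upper g ->
  mx_act g x 0 i = x 0 i + \sum_(j < n | (i < j)%N) x 0 j * g i j.
Proof.
move=> [g1 g0]; rewrite mx_actE (bigD1 i)//= g1 mulr1; congr (_ + _).
rewrite [LHS](bigID (fun j => (i < j)%N))/= [X in _ + X]big1 ?addr0.
  apply: eq_bigl => j; case: ltngtP => //; rewrite ?andbF ?andbT//.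
  by move=> ij; apply/eqP => ji; rewrite ji ltnn in ij.
move=> j /andP[ji]; rewrite -leqNgt leq_eqVlt => /orP[/eqP/val_inj ij|/g0->].
  by rewrite ij eqxx in ji.
by rewrite mulr0.
Qed.

(** The translation (g x)_i - x_i = sum_(j > i) g_ij x_j involves only coordinates beyond i, hence
    does not change with [t]. Coordinates before i may differ, but they have already been integrated
    out when this is used. *)
Lemma mx_act_set_coord (g : 'M[R]_n) x (i : 'I_n) t : unipotent_upper g ->
  agree_from i (mx_act g (set_coord x i t))
    (set_coord (mx_act g x) i (t + (mx_act g x 0 i - x 0 i))).
Proof.
move=> gu j; rewrite leq_eqVlt => /orP[/eqP/val_inj <-|ij].
  rewrite set_coord_ord !mx_act_unipotent// set_coord_ord.
  rewrite [x 0 i + _]addrC addrK; congr (_ + _).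
  by apply: eq_bigr => l il; rewrite set_coord_gt.
rewrite set_coord_gt// !mx_act_unipotent// set_coord_gt//; congr (_ + _).
by apply: eq_bigr => l jl; rewrite set_coord_gt// (ltn_trans ij).
Qed.

Lemma orbit_int_act k M F (g : 'M[R]_n) x : (k <= n)%N -> 0 <= M ->
  continuous F -> support_from 0 M F -> unipotent_upper g ->
  orbit_int k (fun y => F (mx_act g y)) x = orbit_int k F (mx_act g x).
Proof.
move=> kn M0 cF F0 gu; elim: k x kn => [//|k IHk] x kn /=.
under eq_fun do rewrite IHk ?(ltnW kn)//.
pose i := Ordinal kn.
rewrite -[RHS](@lint_shift _ _ M (mx_act g x 0 i - x 0 i)); last 2 first.
- exact: orbit_int_section_continuous (ltnW kn) M0 cF F0.
- by move=> t; exact: orbit_int_section_support.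
(* The two base points agree only from index k on, which is all that [orbit_int k] sees. *)
congr lint; apply/funext => t; apply: orbit_int_agree.
exact: (@mx_act_set_coord g x i t gu).
Qed.

Lemma compact_coord_bound (K : set 'rV[R]_n) : compact K ->
  exists2 M : R, 0 <= M & forall x i, K x -> `|x 0 i| <= M.
Proof.
move=> /compact_bounded[M [_ HM]]; exists (`|M| + 1).
  by rewrite addr_ge0.
move=> x i Kx; apply: (@le_trans _ _ `|x|).
  by rewrite [`|x|]mx_normrE; apply: (le_bigmax _ (fun ij => `|x ij.1 ij.2|) (0, i)).
by apply: HM Kx; have := ler_norm M; lra.
Qed.

Lemma supported_in_from (K : set 'rV[R]_n) M F : supported_in K F ->
  (forall x i, K x -> `|x 0 i| <= M) -> support_from 0 M F.
Proof.
move=> FK KM x i _ Mx; apply/eqP/negPn/negP => Fx.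
by have := KM x i (FK _ Fx); rewrite leNgt Mx.
Qed.

Lemma test_function_support F : test_function F ->
  exists2 M : R, 0 <= M & support_from 0 M F.
Proof.
move=> [_ [K cK FK]]; have [M M0 KM] := compact_coord_bound cK.
by exists M => //; exact: supported_in_from FK KM.
Qed.

Lemma support_fromW k M M' F : M <= M' -> support_from k M F -> support_from k M' F.
Proof. by move=> MM' F0 x i ki M'x; apply: (F0 x i) => //; exact: le_lt_trans M'x. Qed.

(** The real [sup] bounds its set only if that set is bounded above; here the bound comes from the
    compact image of [K], as F is 0 elsewhere. *)
Lemma normr_le_sup_norm (K : set 'rV[R]_n) F x : compact K -> continuous F ->
  supported_in K F -> `|F x| <= sup_norm F.
Proof.
move=> cK cF FK; apply: ub_le_sup; last by exists x.
have /compact_bounded[M [_ HM]] : compact (F @` K).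
  by apply: continuous_compact => //; exact: continuous_subspaceT.
exists (`|M| + 1) => _ [y _ <-].
have [->|Fy] := eqVneq (F y) 0; first by rewrite normr0 addr_ge0.
apply: (HM (`|M| + 1)); first by have := ler_norm M; lra.
by exists y => //; exact: FK.
Qed.

Lemma orbit_int_distribution k x : (k <= n)%N ->
  Defs.distribution (fun F : 'rV[R]_n -> R => orbit_int k F x).
Proof.
move=> kn; split.
  move=> c F G tF tG.
  have [M M0 F0] := test_function_support tF.
  have [M' M'0 G0] := test_function_support tG.
  apply: (@orbit_intD k (M + M')) => //; first exact: addr_ge0.
  - exact: smooth_continuous tF.1.
  - exact: smooth_continuous tG.1.
  - by apply: support_fromW F0; rewrite lerDl.
  - by apply: support_fromW G0; rewrite lerDr.
move=> K cK; have [M M0 KM] := compact_coord_bound cK.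
(* The functional has order 0: no derivatives enter, and the constant is the volume of the cube
   [-M, M]^k. *)
exists 0%N, ((M *+ 2) ^+ k) => F tF FK.
have cF := smooth_continuous tF.1.
rewrite big_ord1 (big_pred1 [tuple]); last by move=> s; apply/esym/eqP; exact: tuple0.
rewrite mulrC; apply: (normr_orbit_int_le _ kn M0 cF).
  exact: supported_in_from FK KM.
by move=> y; exact: normr_le_sup_norm cK cF FK.
Qed.

(** The element g moves the base point x to g x, whose coordinates from i on equal those of x: their
    increments are combinations of the vanishing x_l with l > i. *)
Lemma orbit_int_invariant i x : (forall j, (i < j)%N -> x 0 j = 0) ->
  G_invariant (fun F => orbit_int i F x).
Proof.
move=> x0 g gu F tF; have [M M0 F0] := test_function_support tF.
rewrite (orbit_int_act _ (ltnW (ltn_ord i)) M0 _ F0)//; last first.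
  exact: smooth_continuous tF.1.
apply: orbit_int_agree => j ij; rewrite mx_act_unipotent// big1 ?addr0// => l jl.
by rewrite x0 ?mul0r// (leq_ltn_trans ij).
Qed.

Lemma box_compact M : compact [set x : 'rV[R]_n | forall i, x 0 i \in `[- M, M]].
Proof.
apply: (@rV_compact _ _ (fun=> [set` `[- M, M]])) => _.
exact: segment_compact.
Qed.

Lemma smooth_bump_test M F : 0 <= M -> smooth F ->
  test_function (fun x => F x * bump M x).
Proof.
move=> M0 sF; split; first by apply: smoothM => //; exact: smooth_bump.
(* From x_i^2 <= M one gets |x_i| <= M + 1 for every M >= 0, whereas |x_i| <= M can fail when M <
   1. *)
exists [set x | forall i, x 0 i \in `[- (M + 1), M + 1]]; first exact: box_compact.
move=> x /= Fx i.
have : bump M x != 0 by apply: contraNneq Fx => ->; rewrite mulr0.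
by move=> /bump_support - /(_ i) xM; rewrite in_itv/=; apply/andP; split; nra.
Qed.

End OrbitIntegral.

(** * Vanishing of the coefficient a_k where x_(k+1) = ... = x_n = 0 *)

Section Vanishing.
Context {R : realType} {n : nat}.

(* For T the integral over the orbit {y | y_l = x_l for l >= k} and
   f = (y_k - x_k) a_k chi, Leibniz' rule leaves only the integral of
   a_k^2 chi in sum_i T (d_i (a_i f)). *)
Lemma annihilates_coefficient0 (W : vectType R) (L : W -> 'rV[R]_n -> 'rV[R]_n)
    (w : W) (k : 'I_n) (x : 'rV[R]_n) :
  (forall i, smooth (coefficient L i w)) -> annihilates_invariants L ->
  (forall j : 'I_n, (k < j)%N -> x 0 j = 0) -> coefficient L k w x = 0.
Proof.
move=> sL LT x0; have kn := ltnW (ltn_ord k).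
pose a i := coefficient L i w.
pose M := \sum_(i < n) x 0 i ^+ 2 + 1.
have M0 : 0 <= M by rewrite addr_ge0// sumr_ge0// => i _; exact: sqr_ge0.
pose chi : 'rV[R]_n -> R := bump M.
have schi : smooth chi by exact: smooth_bump.
pose f := fun y : 'rV[R]_n => (y 0 k - x 0 k) * a k y * chi y.
have sxk : smooth (fun y : 'rV[R]_n => y 0 k - x 0 k).
  by apply: smoothD; [exact: smooth_coord|exact: smooth_cst].
have tf : test_function f.
  by apply: smooth_bump_test => //; apply: smoothM => //; exact: sL.
have sh i : smooth (fun y => a i y * (a k y * chi y)).
  by apply: smoothM; [exact: sL|apply: smoothM => //; exact: sL].
(* On the slice y_k = x_k, so only the derivative of y_k - x_k contributes, and it is nonzero only
   for i = k. *)
have dE i y : agree_from k y x ->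
    partial i (fun y => a i y * f y) y = (k == i)%:R * (a i y * (a k y * chi y)).
  move=> yx.
  have -> : (fun y => a i y * f y) =
      (fun y => (y 0 k - x 0 k) * (a i y * (a k y * chi y))).
    by apply/funext => z; rewrite /f; ring.
  rewrite /partial deriveM; [|exact: smooth_derivable..].
  rewrite yx// subrr scale0r add0r /GRing.scale/= mulrC; congr (_ * _).
  have dk := is_deriveD (is_derive_coord i k y)
    (is_derive_cst (- x 0 k) y (delta_mx 0 i)).
  by rewrite (@derive_val _ _ _ _ _ _ _ dk) addr0 eq_sym.
have := LT _ (orbit_int_distribution x kn) (orbit_int_invariant x0) w f tf.
rewrite /distr_mul /distr_partial (bigD1 k)//= big1 ?addr0; last first.
  move=> i ik; apply/eqP; rewrite oppr_eq0 -(orbit_int0 k x); apply/eqP.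
  by apply: eq_orbit_int => y yx; rewrite dE// eq_sym (negbTE ik) mul0r.
move/eqP; rewrite oppr_eq0 => /eqP.
rewrite (eq_orbit_int (G := fun y => a k y * (a k y * chi y))); last first.
  by move=> y yx; rewrite dE// eqxx mul1r.
move=> T0; apply/eqP/negPn/negP => ax.
have [N N0 hN] : exists2 N : R, 0 <= N &
    support_from 0 N (fun y => a k y * (a k y * chi y)).
  apply: test_function_support.
  under eq_fun do rewrite mulrA.
  by apply: smooth_bump_test => //; apply: smoothM; exact: sL.
(* The integrand a_k^2 chi is continuous and nonnegative, and positive at x if a_k(x) is nonzero,
   since M = |x|^2 + 1 makes chi(x) > 0. *)
suff : 0 < orbit_int k (fun y => a k y * (a k y * chi y)) x by rewrite T0 ltxx.
apply: (orbit_int_gt0 kn N0 _ hN).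
- exact: smooth_continuous (sh k).
- by move=> y; rewrite mulrA mulr_ge0 ?bump_ge0// -expr2 sqr_ge0.
- rewrite mulrA mulr_gt0//; last by apply: bump_gt0; rewrite ltrDl.
  by rewrite -expr2 exprn_even_gt0.
Qed.

End Vanishing.

(** Freezes the parameters. Partial derivatives of a restriction are restrictions of partial
    derivatives in the shifted directions, so the restrictions form a stable class. *)
Lemma smooth_row_mx {R : realType} (d n : nat) (u : 'rV[R]_d)
    (f : 'rV[R]_(d + n) -> R) :
  smooth f -> smooth (fun x => f (row_mx u x)).
Proof.
move=> sf; apply: (@smooth_coind _ _ (fun h => exists2 f, smooth f &
  h = fun x => f (row_mx u x))); last by exists f.
move=> _ [{}f {}sf ->].
have lineE (i : 'I_n) x (h : R) : row_mx u (h *: delta_mx 0 i + x) =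
    h *: delta_mx 0 (rshift d i) + row_mx u x.
  apply/rowP => l; rewrite -[l]splitK; case: (fintype.split l) => j /=.
    by rewrite !mxE (unsplitK (inl j)) eq_lrshift mulr0 add0r.
  by rewrite !mxE (unsplitK (inr j)) !mxE !eqxx/= eq_rshift.
have df (i : 'I_n) x : is_derive x (delta_mx 0 i) (fun x => f (row_mx u x))
    (partial (rshift d i) f (row_mx u x)).
  have dfi : is_derive (row_mx u x) (delta_mx 0 (rshift d i)) f
      (partial (rshift d i) f (row_mx u x)).
    by split; first exact: smooth_derivable.
  move/is_derive_line in dfi; apply/is_derive_line.
  by under eq_fun do rewrite lineE.
split.
  move=> x; apply: (@continuous_comp _ _ _ (row_mx u) f).
    apply: row_continuous => {x} l.
    have -> : (fun x : 'rV[R]_n => row_mx u x 0 l) =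
        fun x => match fintype.split l with inl j => u 0 j | inr j => x 0 j end.
      by apply/funext => x; rewrite mxE.
    by case: (fintype.split l) => j; [exact: cst_continuous|exact: coord_continuous].
  exact: smooth_continuous.
move=> i; split; first by move=> x; have [] := df i x.
exists (partial (rshift d i) f); first exact: smooth_partial.
by apply/funext => x; exact: (@derive_val _ _ _ _ _ _ _ (df i x)).
Qed.

(** * Decomposition of L over W x R^n *)

Section Decomposition.
Context {R : realType} {n : nat} {W : vectType R}.
Local Notation v2r := (@VectorInternalTheory.v2r R W).
Local Notation r2v := (@VectorInternalTheory.r2v R W).
Local Notation d := (dim W).

Definition on_coords (F : W -> 'rV[R]_n -> R) (z : 'rV[R]_(d + n)) : R :=
  F (r2v (lsubmx z)) (rsubmx z).

Lemma polynomial_on_prodE F : polynomial_on_prod F <-> polyfun (on_coords F).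
Proof.
split=> -[p pE]; exists p.
  by move=> z; rewrite /on_coords pE VectorInternalTheory.r2vK hsubmxK.
move=> w x; have := pE (row_mx (v2r w) x).
by rewrite /on_coords row_mxKl row_mxKr VectorInternalTheory.v2rK.
Qed.

(** Treats the smooth and the polynomial case at once: [C] must consist of smooth functions, for the
    vanishing of the coefficients, and admit Hadamard quotients within [C]. *)
Lemma decomposition (C : ('rV[R]_(d + n) -> R) -> Prop)
    (L : W -> 'rV[R]_n -> 'rV[R]_n) :
  (forall f, C f -> smooth f) ->
  (forall f P, C f -> exists2 phi : 'I_(d + n) -> 'rV[R]_(d + n) -> R,
     (forall j, C (phi j)) &
     forall z, f z = f (zero_coords P z) + \sum_(j | P j) z 0 j * phi j z) ->
  (forall i, C (on_coords (coefficient L i))) ->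
  annihilates_invariants L ->
  exists phi : 'I_n -> 'I_n -> W -> 'rV[R]_n -> R,
     (forall i j : 'I_n, (i < j)%N -> C (on_coords (phi i j))) /\
     (forall (w : W) (x : 'rV[R]_n),
        L w x = \sum_(i < n) \sum_(j < n | (i < j)%N)
                  phi i j w x *: Lfield i j x).
Proof.
move=> Csmooth CH CL LT.
(* Only coordinates of R^n beyond i are set to 0, never those of W. For the last i nothing is
   selected: the sum is empty and the coefficient is identically 0. *)
pose P (i : 'I_n) (l : 'I_(d + n)) :=
  if fintype.split l is inr j then (i < j)%N else false.
have {}CH i := CH _ (P i) (CL i).
have {CH} /choice[phi phiP] : forall i, exists phi : 'I_(d + n) -> 'rV[R]_(d + n) -> R,
    (forall j, C (phi j)) /\ forall z, on_coords (coefficient L i) z =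
    on_coords (coefficient L i) (zero_coords (P i) z) +
      \sum_(j | P i j) z 0 j * phi j z.
  by move=> i; have [phi ? ?] := CH i; exists phi.
exists (fun i j w x => phi i (rshift d j) (row_mx (v2r w) x)); split.
  move=> i j _; have -> : on_coords (fun w x => phi i (rshift d j) (row_mx (v2r w) x)) =
      phi i (rshift d j).
    by apply/funext => z; rewrite /on_coords VectorInternalTheory.r2vK hsubmxK.
  exact: (phiP i).1.
move=> w x; apply/rowP => i; rewrite summxE (bigD1 i)//= [X in _ + X]big1 ?addr0; last first.
  move=> l li; rewrite summxE big1// => j _.
  by rewrite !mxE eq_sym (negbTE li) andbF !mulr0.
rewrite summxE.
have := (phiP i).2 (row_mx (v2r w) x).
rewrite {1}/on_coords row_mxKl row_mxKr VectorInternalTheory.v2rK /coefficient => ->.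
(* The R^n component of this point has zero coordinates beyond i, so the vanishing result applies to
   the field frozen at its W component. *)
have -> : on_coords (coefficient L i) (zero_coords (P i) (row_mx (v2r w) x)) = 0.
  rewrite /on_coords; apply: annihilates_coefficient0 LT _ => [l|j ij].
    have := smooth_row_mx (v2r (r2v (lsubmx (zero_coords (P i) (row_mx (v2r w) x)))))
      (Csmooth _ (CL l)).
    under eq_fun do rewrite /on_coords row_mxKl row_mxKr VectorInternalTheory.v2rK.
    by [].
  by rewrite !mxE /P (unsplitK (inr j)) ij.
rewrite add0r big_split_ord/= big_pred0 ?add0r => [|j]; last first.
  by rewrite /P (unsplitK (inl j)).
rewrite (eq_bigl (fun j : 'I_n => (i < j)%N)) => [|j]; last first.
  by rewrite /P (unsplitK (inr j)).
apply: eq_bigr => j _.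
by rewrite row_mxEr !mxE !eqxx/= mulr1 mulrC.
Qed.

End Decomposition.

Theorem mainTheorem3 (R : realType) (n : nat) (hn : (2 <= n)%N)
    (W : vectType R) (L : W -> 'rV[R]_n -> 'rV[R]_n) :
  ((forall i : 'I_n, smooth_on_prod (coefficient L i)) ->
   annihilates_invariants L ->
   exists phi : 'I_n -> 'I_n -> W -> 'rV[R]_n -> R,
     (forall i j : 'I_n, (i < j)%N -> smooth_on_prod (phi i j)) /\
     (forall (w : W) (x : 'rV[R]_n),
        L w x = \sum_(i < n) \sum_(j < n | (i < j)%N)
                  phi i j w x *: Lfield i j x))
  /\
  ((forall i : 'I_n, polynomial_on_prod (coefficient L i)) ->
   annihilates_invariants L ->
   exists phi : 'I_n -> 'I_n -> W -> 'rV[R]_n -> R,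
     (forall i j : 'I_n, (i < j)%N -> polynomial_on_prod (phi i j)) /\
     (forall (w : W) (x : 'rV[R]_n),
        L w x = \sum_(i < n) \sum_(j < n | (i < j)%N)
                  phi i j w x *: Lfield i j x)).
Proof.
split=> CL LT.
  by apply: (decomposition (C := @smooth R (dim W + n))) => // f P; exact: smooth_Hadamard.
have [||i|//|phi [pphi phiE]] := decomposition (C := @polyfun R (dim W + n)) (L := L).
- exact: polyfun_smooth.
- by move=> f P; exact: polyfun_Hadamard.
- exact/polynomial_on_prodE.
by exists phi; split => // i j ij; exact/polynomial_on_prodE/pphi.
Qed.
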